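(* Let $u:U\to[-\infty,\infty)$ be strictly $q$-plurisubharmonic on a non-empty open set $U\subset\mathbb{C}^n$, for an integer $q\geq 0$. Let $\Phi:\mathbb{C}^n\to\mathbb{R}$ be continuous and semiconvex with constant $\delta>0$. Given any open set $\Omega$ compactly contained in $U$ (i.e. $\overline{\Omega}$ is compact and $\overline{\Omega}\subset U$), assume that the proper set of definition for the sup-convolution $[u|_\Omega]_\Omega^\Phi$ has non-empty interior $W\neq\emptyset$. Then the restriction of $[u|_\Omega]_\Omega^\Phi$ to $W$ is continuous and strictly $q$-plurisubharmonic on $W$.
   Context: Definitions. Let $U\subset\mathbb{C}^n$ be open and $u:U\to[-\infty,\infty)$ upper semi-continuous. (i) $u$ is subpluriharmonic on $U$ if either $u\equiv-\infty$ on $U$, or for every compact ball $\overline{B}\subset U$ and every continuous plurisubharmonic function $h$ defined in a neighborhood of $\overline{B}$, the restriction of $u+h$ to $\overline{B}$ attains its maximum on the boundary $bB$. (ii) For an integer $0\leq q<n$, $u$ is $q$-plurisubharmonic on $U$ if it is subpluriharmonic on $U\cap\pi$ for every $(q+1)$-dimensional complex affine subspace $\pi$ of $\mathbb{C}^n$ (where $\pi$ is identified with $\mathbb{C}^{q+1}$). For integers $q\geq n$, by convention every upper semi-continuous function is $q$-plurisubharmonic. (iii) An upper semi-continuous $u:U\to[-\infty,\infty)$ on a non-empty open set $U$ is strictly $q$-plurisubharmonic on $U$ if for every $y\in U$ there are a real $\varepsilon>0$ and a non-empty open ball $B\subset U$ centred at $y$ such that the restriction of $u-\varepsilon\|\cdot\|^2$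 to $B$ is $q$-plurisubharmonic on $B$ ($\|\cdot\|$ is the Euclidean norm). In particular $u\equiv-\infty$ is strictly $q$-plurisubharmonic. (iv) For a non-empty set $X\subset\mathbb{C}^n$ and upper semi-continuous functions $v:X\to[-\infty,\infty)$ and $\Phi:\mathbb{C}^n\to[-\infty,\infty)$, the sup-convolution is $v_X^\Phi(y):=\sup_{x\in X}\{v(x)+\Phi(y-x)\}\in[-\infty,\infty]$ for $y\in\mathbb{C}^n$. The proper set of definition for $v_X^\Phi$ is the set of those $y\in\mathbb{C}^n$ for which there is $\hat{x}\in X$ with $v_X^\Phi(y)=v(\hat{x})+\Phi(y-\hat{x})$. (v) $\Phi$ is semiconvex with constant $\delta>0$ if $\Phi+\delta\|\cdot\|^2$ is convex on $\mathbb{C}^n$. Convention: a function with values in $[-\infty,\infty)$ that is identically $-\infty$ (a constant function) is regarded as continuous. *)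

(* Defs.v *)
From HB Require Import structures.
From mathcomp Require Export all_boot all_order all_algebra.
From mathcomp Require Export complex.
From mathcomp Require Export all_classical all_reals all_analysis.
Set Implicit Arguments.
Unset Strict Implicit.
Unset Printing Implicit Defensive.
Import Order.TTheory GRing.Theory Num.Theory.
Import numFieldNormedType.Exports.
Local Open Scope classical_set_scope.
Local Open Scope ring_scope.
Local Open Scope complex_scope.

(* The topology of R[i] given by the modulus.  The library provides it for
   abstract numFieldTypes only; with this instance 'rV[R[i]]_n, which stands
   for C^n, gets the product topology. *)
HB.instance Definition _ (R : realType) := NormedModule.copy R[i] R[i]^o.

(* The norm the library puts on matrices is the sup norm (with values in R[i]),
   hence the explicit Euclidean norm; both induce the same topology. *)
Definition enorm (R : realType) (n : nat) (z : 'rV[R[i]]_n) : R :=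
  Num.sqrt (\sum_(j < n)
    (complex.Re (z 0 j) ^+ 2 + complex.Im (z 0 j) ^+ 2)).

Definition eball (R : realType) (n : nat) (c : 'rV[R[i]]_n) (r : R)
  : set 'rV[R[i]]_n := [set z | enorm (z - c) < r].

Definition ecball (R : realType) (n : nat) (c : 'rV[R[i]]_n) (r : R)
  : set 'rV[R[i]]_n := [set z | enorm (z - c) <= r].

Definition esphere (R : realType) (n : nat) (c : 'rV[R[i]]_n) (r : R)
  : set 'rV[R[i]]_n := [set z | enorm (z - c) = r].

(* Functions X -> [-oo, +oo) are represented by total functions into \bar R of
   which only the values on X matter; [usc_on X u] says that u maps X to
   [-oo, +oo) and is upper semi-continuous on X. *)
Definition usc_on (R : realType) (n : nat) (X : set 'rV[R[i]]_n)
    (u : 'rV[R[i]]_n -> \bar R) : Prop :=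
  forall x, X x ->
    (u x < +oo)%E /\
    forall a : R, (u x < a%:E)%E -> \forall y \near x, X y -> (u y < a%:E)%E.

(* Plurisubharmonicity on an open set V: upper semi-continuity and the
   sub-mean value inequality over the boundary circle of every closed (affine)
   complex disc contained in V; the constant -oo is allowed. *)
Definition plurisubharmonic (R : realType) (n : nat) (V : set 'rV[R[i]]_n)
    (h : 'rV[R[i]]_n -> \bar R) : Prop :=
  usc_on V h /\
  forall a b : 'rV[R[i]]_n,
    (forall l : R[i], `|l| <= 1 -> V (a + l *: b)) ->
    (h a <= ((2 * pi)^-1)%:E *
      \int[@lebesgue_measure R]_(t in `[0%R, (2 * pi)%R])
        h (a + (cos t +i* sin t)%C *: b)%R)%E.

(* Continuity of h is with respect to the topology of \bar R, so h may take
   the value -oo. *)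
Definition subpluriharmonic (R : realType) (n : nat) (U : set 'rV[R[i]]_n)
    (u : 'rV[R[i]]_n -> \bar R) : Prop :=
  (forall z, U z -> u z = -oo%E) \/
  forall (c : 'rV[R[i]]_n) (r : R) (V : set 'rV[R[i]]_n)
         (h : 'rV[R[i]]_n -> \bar R),
    0 < r -> ecball c r `<=` U ->
    open V -> ecball c r `<=` V ->
    {within V, continuous h} -> plurisubharmonic V h ->
    exists2 z, esphere c r z &
      forall w, ecball c r w -> (u w + h w <= u z + h z)%E.

(* A (q+1)-dimensional complex affine subspace is the image of an affine map
   t |-> a + t *m M.  The q+1 rows of M are taken orthonormal
   (M *m M^t* = 1%:M), so that this map identifies C^(q+1) isometrically with
   the subspace and compact balls correspond to compact balls. *)
Definition qpsh (R : realType) (n : nat) (q : nat) (U : set 'rV[R[i]]_n)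
    (u : 'rV[R[i]]_n -> \bar R) : Prop :=
  usc_on U u /\
  ((q < n)%N ->
   forall (a : 'rV[R[i]]_n) (M : 'M[R[i]]_(q.+1, n)), M \is unitarymx ->
     subpluriharmonic [set t : 'rV[R[i]]_q.+1 | U (a + t *m M)]
                      (fun t => u (a + t *m M))).

Definition strictly_qpsh (R : realType) (n : nat) (q : nat)
    (U : set 'rV[R[i]]_n) (u : 'rV[R[i]]_n -> \bar R) : Prop :=
  usc_on U u /\
  forall y, U y -> exists e r : R,
    [/\ 0 < e, 0 < r, eball y r `<=` U &
        qpsh q (eball y r) (fun z => u z - (e * enorm z ^+ 2)%:E)%E].

Definition supconv (R : realType) (n : nat) (X : set 'rV[R[i]]_n)
    (v Phi : 'rV[R[i]]_n -> \bar R) (y : 'rV[R[i]]_n) : \bar R :=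
  ereal_sup [set (v x + Phi (y - x)%R)%E | x in X].

Definition proper_supconv (R : realType) (n : nat) (X : set 'rV[R[i]]_n)
    (v Phi : 'rV[R[i]]_n -> \bar R) : set 'rV[R[i]]_n :=
  [set y | exists2 x, X x & supconv X v Phi y = (v x + Phi (y - x)%R)%E].

(* [convex_function] needs a module over R, whereas 'rV[R[i]]_n is a module
   over R[i]. *)
Definition convexCn (R : realType) (n : nat) (f : 'rV[R[i]]_n -> R) : Prop :=
  forall (x y : 'rV[R[i]]_n) (t : R), 0 <= t <= 1 ->
    f (t%:C *: x + (1 - t)%:C *: y) <= t * f x + (1 - t) * f y.

Definition semiconvex (R : realType) (n : nat) (Phi : 'rV[R[i]]_n -> R)
    (delta : R) : Prop :=
  convexCn (fun x => Phi x + delta * enorm x ^+ 2).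

(* Main.v *)
Require Import Defs.
From mathcomp Require Import all_boot all_order all_algebra.
From mathcomp Require Import complex.
From mathcomp Require Import all_classical all_reals all_analysis.
From mathcomp Require Import ring lra.
Import Order.TTheory GRing.Theory Num.Theory.
Import numFieldNormedType.Exports.
Local Open Scope classical_set_scope.
Local Open Scope ring_scope.
Set Implicit Arguments.
Unset Strict Implicit.
Unset Printing Implicit Defensive.

(** Write w for the sup-convolution. Two facts about w near a point y0 carry the
    proof.

    Continuity. For y near y0 the functions x |-> Phi (y - x) and
    x |-> Phi (y0 - x) are uniformly close on the compact closure of Omega
    ([near_translates_uniform]), hence so are the suprema w y and w y0: w is
    continuous wherever it is not +oo ([supconv_continuous_at]). On W the
    supremum is a value u x + Phi (y - x), which is not +oo.

    Touching. If the supremum at y0 is attained at x, then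
    u (x + d) + Phi (y0 - x) <= w (y0 + d) for all small d, with equality at
    d = 0: a translate of u, up to a constant, touches w from below at y0.

    By compactness there is e > 0 such that near each point of the closure of
    Omega the function u - e' |.|^2 is q-plurisubharmonic for some e' > e
    ([strictly_qpsh_uniform]). The claim is that w - e |.|^2 is
    q-plurisubharmonic on W. On a closed ball of a (q+1)-dimensional slice, the
    continuous function w - e |.|^2 + h attains its maximum; suppose it does so
    at an interior point y0 = a + t0 M and not on the boundary. By touching,
    s |-> u (x + s M) - e |y0 + s M|^2 + h (t0 + s) has a local maximum at 0.
    Since M is an isometry, |y0 + s M|^2 differs from |x + s M|^2 by a constant
    and a real-linear term, so this function is, up to a constant,
      (u - e' |.|^2) (x + s M) + (h (t0 + s) + L s) + (e' - e) |s|^2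
    with L real-linear. A real-linear function is harmonic on complex discs, so
    h + L is plurisubharmonic ([psh_add_circle_affine]), and the sum of the
    first two terms has on each small sphere a value at least that at the
    centre. The last term makes the total strictly larger there, which
    contradicts the local maximum ([qpsh_no_local_max]). *)

(** * Topology of the complex plane and of complex n-space *)

Lemma gt0_complexE (R : realType) (e : R[i]) : 0 < e ->
  exists2 r : R, 0 < r & e = r%:C%C.
Proof.
by case: e => a b; rewrite ltcE /= => /andP[/eqP -> a0]; exists a.
Qed.

Lemma continuous_Re (R : realType) : continuous (@complex.Re R : R[i] -> R).
Proof.
move=> z A /nbhs_ballP[e /= e0 eA]; apply/nbhs_ballP; exists e%:C%C => /=.
  by rewrite ltcR.
move=> w; rewrite /ball /= => zw; apply: eA; rewrite /ball /=.
rewrite -ltcR; apply: le_lt_trans zw.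
by apply: le_trans (normc_ge_Re _); rewrite raddfB.
Qed.

Lemma continuous_Im (R : realType) : continuous (@complex.Im R : R[i] -> R).
Proof.
have -> : @complex.Im R = (fun z => complex.Re (- 'i%C * z)).
  by apply/funext => -[a b] /=; rewrite oppr0 mul0r mulN1r opprK add0r.
move=> z; apply: (@continuous_comp _ _ _ (fun z => - 'i%C * z)); last first.
  exact: continuous_Re.
exact: mulrl_continuous.
Qed.

Lemma cvg_complex (R : realType) (T : Type) (F : set_system T) (f g : T -> R)
    (a b : R) : Filter F ->
  f x @[x --> F] --> a -> g x @[x --> F] --> b ->
  (f x +i* g x)%C @[x --> F] --> (a +i* b)%C.
Proof.
move=> FF fa gb A /nbhs_ballP[e /= e0 eA].
have [r r0 er] := gt0_complexE e0; have h : 0 < r / 2 by rewrite divr_gt0.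
have /cvgr_dist_lt/(_ _ h) Hf := fa.
have /cvgr_dist_lt/(_ _ h) Hg := gb.
suff : \forall x \near F, A (f x +i* g x)%C by [].
near=> x; apply: eA; rewrite /ball /= er ltcR.
have : `|a - f x| < r / 2 by near: x.
have : `|b - g x| < r / 2 by near: x.
rewrite !ltr_norml => /andP[b1 b2] /andP[a1 a2].
by rewrite -[ltRHS](@gtr0_norm _ r) // -sqrtr_sqr ltr_sqrt; nra.
Unshelve. all: by end_near. Qed.

Lemma cvg_rV (R : realType) n (T : Type) (F : set_system T)
    (f : T -> 'rV[R[i]]_n) (l : 'rV[R[i]]_n) : Filter F ->
  (forall j, f x 0 j @[x --> F] --> l 0 j) -> f x @[x --> F] --> l.
Proof.
move=> FF fl A [P Pl PA].
suff : \forall x \near F, forall j, P 0 j (f x 0 j).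
  by apply: filterS => x Px; apply: PA => i j; rewrite ord1.
by apply: filter_forall => j; apply: fl.
Qed.

Lemma continuous_translate (R : realType) m (c : 'rV[R[i]]_m) :
  continuous (fun s : 'rV[R[i]]_m => c + s).
Proof.
move=> s; exact: (@cvgD R[i] 'rV[R[i]]_m _ (nbhs s) _ (cst c) id c s
  (cvg_cst _) cvg_id).
Qed.

Lemma continuous_mulmxr (R : realType) m n (M : 'M[R[i]]_(m, n)) :
  continuous (fun s : 'rV[R[i]]_m => s *m M).
Proof.
move=> s; apply: (@cvg_rV _ _ _ (nbhs s)) => j.
suff : continuous (fun t : 'rV[R[i]]_m => (t *m M) 0 j) by exact.
under eq_fun do rewrite mxE.
apply: continuous_big => [|k _ t]; first exact: add_continuous.
exact: (cvgMl (@coord_continuous R[i] 1 m 0 k t)).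
Qed.

Lemma continuous_affine (R : realType) m n (b : 'rV[R[i]]_n)
    (M : 'M[R[i]]_(m, n)) :
  continuous (fun t : 'rV[R[i]]_m => b + t *m M).
Proof.
move=> t; have Mt : (fun s : 'rV[R[i]]_m => s *m M) @ t --> t *m M.
  exact: continuous_mulmxr.
exact: (@cvgD R[i] 'rV[R[i]]_n _ (nbhs t) _ (cst b) _ b _ (cvg_cst _) Mt).
Qed.

(** * Euclidean norm and balls *)

Lemma norm_coord_le_enorm (R : realType) n (z : 'rV[R[i]]_n) j :
  `|z 0 j| <= (enorm z)%:C%C.
Proof.
rewrite normc_def lecR /enorm ler_wsqrtr // (bigD1 j) //= lerDl.
by apply: sumr_ge0 => i _; rewrite addr_ge0 // sqr_ge0.
Qed.

Lemma enorm0 (R : realType) n : enorm (0 : 'rV[R[i]]_n) = 0.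
Proof.
by rewrite /enorm big1 ?sqrtr0 // => j _; rewrite mxE /= !expr0n /= addr0.
Qed.

Lemma enormN (R : realType) n (z : 'rV[R[i]]_n) : enorm (- z) = enorm z.
Proof.
congr Num.sqrt; apply: eq_bigr => j _.
by rewrite mxE !raddfN !sqrrN.
Qed.

Lemma continuous_enorm (R : realType) n :
  continuous (@enorm R n : 'rV[R[i]]_n -> R).
Proof.
move=> z; rewrite /enorm.
apply: (@continuous_comp _ _ _
  (fun z : 'rV[R[i]]_n => \sum_(j < n)
    (complex.Re (z 0 j) ^+ 2 + complex.Im (z 0 j) ^+ 2)) (@Num.sqrt R));
  last exact: sqrt_continuous.
move: z; apply: continuous_big => [|j _ z]; first exact: add_continuous.
have sqr_comp (f : R[i] -> R) : continuous f ->
    (fun w : 'rV[R[i]]_n => f (w 0 j) ^+ 2) @ z --> f (z 0 j) ^+ 2.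
  move=> cf; apply: (@continuous_comp _ _ _ (fun w : 'rV[R[i]]_n => f (w 0 j))
    (fun x : R => x ^+ 2)); last exact: exprn_continuous.
  apply: (@continuous_comp _ _ _ (fun w : 'rV[R[i]]_n => w 0 j) f).
    exact: coord_continuous.
  exact: cf.
have Re2 := sqr_comp _ (@continuous_Re R).
have Im2 := sqr_comp _ (@continuous_Im R).
exact: (cvgD Re2 Im2).
Qed.

Lemma continuous_enorm_sub (R : realType) n (c : 'rV[R[i]]_n) :
  continuous (fun z : 'rV[R[i]]_n => enorm (z - c)).
Proof.
move=> z; apply: (@continuous_comp _ _ _ (fun w : 'rV[R[i]]_n => w - c)
  (@enorm R n)); last exact: continuous_enorm.
exact: (@cvgB R[i] 'rV[R[i]]_n _ (nbhs z) _ id (cst c) z c cvg_id (cvg_cst _)).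
Qed.

Lemma open_eball (R : realType) n (c : 'rV[R[i]]_n) (r : R) : open (eball c r).
Proof.
have -> : eball c r = (fun z => enorm (z - c)) @^-1` [set x | x < r] by [].
apply: open_comp; last exact: open_lt.
by move=> z _; exact: continuous_enorm_sub.
Qed.

Lemma nbhs_eball (R : realType) n (z : 'rV[R[i]]_n) (r : R) :
  0 < r -> \forall w \near z, eball z r w.
Proof.
move=> r0; apply: open_nbhs_nbhs; split; first exact: open_eball.
by rewrite /eball /= subrr enorm0.
Qed.

Lemma nbhs_eballP (R : realType) n (z : 'rV[R[i]]_n) (A : set 'rV[R[i]]_n) :
  nbhs z A <-> exists2 r : R, 0 < r & eball z r `<=` A.
Proof.
split=> [/nbhs_ballP[e /= e0 eA]|[r r0 rA]]; last first.
  by apply: filterS rA _; exact: nbhs_eball.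
have [r r0 er] := gt0_complexE e0.
exists r => // w; rewrite /eball /= => wz; apply: eA.
split=> // i j; rewrite ord1 /ball /=.
rewrite er; have := norm_coord_le_enorm (z - w) j.
rewrite !mxE => /le_lt_trans; apply.
by rewrite ltcR -enormN opprB.
Qed.

Lemma esphere_neq0 (R : realType) m (c : 'rV[R[i]]_m.+1) (r : R) : 0 < r ->
  exists z, esphere c r z.
Proof.
move=> r0; exists (c + r%:C%C *: delta_mx 0 0).
rewrite /esphere /= addrAC subrr add0r /enorm big_ord_recl big1 => [|j _].
  rewrite !mxE /= ?(mulr1, mulr0, mul0r, mul1r, addr0, subr0, add0r, oppr0).
  by rewrite expr0n addr0 sqrtr_sqr gtr0_norm.
by rewrite !mxE mulr0 /= expr0n addr0.
Qed.

Lemma compact_ecball (R : realType) n (c : 'rV[R[i]]_n) (r : R) :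
  compact (ecball c r).
Proof.
(* The ball is a closed subset of a product of closed squares. *)
pose rect (j : 'I_n) := (fun p : R * R => (p.1 +i* p.2)%C) @`
  (`[complex.Re (c 0 j) - r, complex.Re (c 0 j) + r] `*`
   `[complex.Im (c 0 j) - r, complex.Im (c 0 j) + r]).
have rectK j : compact (rect j).
  apply: continuous_compact.
    apply: continuous_subspaceT => p.
    by apply: cvg_complex; [exact: cvg_fst|exact: cvg_snd].
  by apply: compact_setX; exact: segment_compact.
apply: subclosed_compact (rV_compact rectK) _.
  have -> : ecball c r = (fun z => enorm (z - c)) @^-1` [set x | x <= r] by [].
  apply: closed_comp; last exact: closed_le.
  by move=> z _; exact: continuous_enorm_sub.
move=> z; rewrite /ecball /= => zr j.
have := le_trans (norm_coord_le_enorm (z - c) j); rewrite !mxE => zj.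
exists (complex.Re (z 0 j), complex.Im (z 0 j)); last by case: (z 0 j).
have /zj : (enorm (z - c))%:C%C <= r%:C%C by rewrite lecR.
rewrite normc_def lecR => zjr.
have r0 : 0 <= r by apply: le_trans zr; exact: sqrtr_ge0.
rewrite raddfB/= raddfB/= in zjr; move: zjr.
rewrite -[leRHS](@ger0_norm _ r) // -sqrtr_sqr ler_sqrt ?sqr_ge0 // => zjr.
have sqle (x y : R) : x ^+ 2 + y ^+ 2 <= r ^+ 2 -> `|x| <= r.
  move=> xyr; rewrite -(@ger0_norm _ r) // -ler_sqr ?nnegrE //.
  rewrite !real_normK ?num_real //; apply: le_trans xyr.
  by rewrite lerDl sqr_ge0.
have := sqle _ _ zjr; rewrite addrC in zjr; have := sqle _ _ zjr.
by rewrite !ler_norml => ? ?; split; rewrite /= in_itv /=; lra.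
Qed.

(** * The real inner product *)

(** The real part of the Hermitian product, that is, the Euclidean inner
    product of C^n seen as R^(2n); expanding a squared norm produces it. *)
Definition rdot (R : realType) (n : nat) (x y : 'rV[R[i]]_n) : R :=
  \sum_(j < n) (complex.Re (x 0 j) * complex.Re (y 0 j) +
                complex.Im (x 0 j) * complex.Im (y 0 j)).

Lemma sqr_enorm (R : realType) n (z : 'rV[R[i]]_n) : enorm z ^+ 2 = rdot z z.
Proof.
rewrite sqr_sqrtr; last first.
  by apply: sumr_ge0 => j _; rewrite addr_ge0 // sqr_ge0.
by apply: eq_bigr => j _; rewrite !expr2.
Qed.

Lemma sqr_enormD (R : realType) n (x y : 'rV[R[i]]_n) :
  enorm (x + y) ^+ 2 = enorm x ^+ 2 + 2 * rdot x y + enorm y ^+ 2.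
Proof.
rewrite !sqr_enorm /rdot mulr_sumr -!big_split /=; apply: eq_bigr => j _.
by rewrite mxE !raddfD /=; ring.
Qed.

Lemma rdot_circle (R : realType) n (p a b : 'rV[R[i]]_n) (c s : R) :
  rdot p (a + (c +i* s)%C *: b) =
  rdot p a + rdot p b * c + rdot p ('i%C *: b) * s.
Proof.
rewrite /rdot !mulr_suml -!big_split /=; apply: eq_bigr => j _.
by rewrite !mxE; case: (a 0 j) (b 0 j) => [? ?] [? ?] /=; ring.
Qed.

Lemma continuous_rdot (R : realType) n (p : 'rV[R[i]]_n) :
  continuous (rdot p).
Proof.
apply: continuous_big => [|j _ z]; first exact: add_continuous.
have coord (f : R[i] -> R) (a : R) : continuous f ->
    (fun w : 'rV[R[i]]_n => a * f (w 0 j)) @ z --> a * f (z 0 j).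
  move=> cf; have fj : (fun w : 'rV[R[i]]_n => f (w 0 j)) @ z --> f (z 0 j).
    apply: (@continuous_comp _ _ _ (fun w : 'rV[R[i]]_n => w 0 j) f).
      exact: coord_continuous.
    exact: cf.
  exact: (cvgMr fj).
have Rep := coord _ (complex.Re (p 0 j)) (@continuous_Re R).
have Imp := coord _ (complex.Im (p 0 j)) (@continuous_Im R).
exact: (cvgD Rep Imp).
Qed.

Lemma continuous_rdot_mulmxr (R : realType) m n (M : 'M[R[i]]_(m, n))
    (p q : 'rV[R[i]]_n) (b1 b2 : R) :
  continuous (fun s : 'rV[R[i]]_m =>
    b1 * rdot p (s *m M) + b2 * rdot q (s *m M)).
Proof.
move=> s; have term (a : R) (x : 'rV[R[i]]_n) :
    (fun s : 'rV[R[i]]_m => a * rdot x (s *m M)) @ s --> a * rdot x (s *m M).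
  have xM : (fun s : 'rV[R[i]]_m => rdot x (s *m M)) @ s --> rdot x (s *m M).
    apply: (@continuous_comp _ _ _ (fun s : 'rV[R[i]]_m => s *m M)).
      exact: continuous_mulmxr.
    exact: continuous_rdot.
  exact: (cvgMr xM).
exact: (cvgD (term b1 p) (term b2 q)).
Qed.

(** The rows of M are orthonormal, so that t |-> a + t *m M is an isometry onto
    a complex affine subspace. *)
Lemma enorm_unitary (R : realType) m n (M : 'M[R[i]]_(m, n)) (s : 'rV[R[i]]_m) :
  M \is unitarymx -> enorm (s *m M) = enorm s.
Proof.
move=> /unitarymxP MM.
have sqE k (z : 'rV[R[i]]_k) : 
    (enorm z ^+ 2)%:C%C = (z *m map_mx Num.conj (z^T)) 0 0.
  rewrite sqr_enorm mxE raddf_sum /=; apply: eq_bigr => j _.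
  by rewrite !mxE -normCK -add_Re2_Im2 !expr2.
apply/eqP; rewrite -(eqrXn2 (n := 2)) ?sqrtr_ge0 //.
apply/eqP/complexI; rewrite !sqE trmx_mul map_mxM /=.
by rewrite mulmxA -(mulmxA s) MM mulmx1.
Qed.

(** * Semicontinuity and compactness *)

Lemma lty_fin_num (R : realType) (x : \bar R) :
  (x < +oo)%E -> x != -oo%E -> x \is a fin_num.
Proof. by move=> xy xN; rewrite fin_numE xN -ltey. Qed.

Lemma continuous_lt (R : realType) (T : topologicalType) (f : T -> \bar R)
    (x : T) (a : \bar R) :
  f @ x --> f x -> (f x < a)%E -> \forall y \near x, (f y < a)%E.
Proof. by move=> cf fa; have := cf _ (open_ereal_lt' fa). Qed.

Lemma continuous_gt (R : realType) (T : topologicalType) (f : T -> \bar R)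
    (x : T) (a : \bar R) :
  f @ x --> f x -> (a < f x)%E -> \forall y \near x, (a < f y)%E.
Proof. by move=> cf fa; have := cf _ (open_ereal_gt' fa). Qed.

(** Only the order of the values matters, so this covers functions that take the
    value -oo. *)
Lemma usc_attains_max (d : Order.disp_t) (L : orderType d) (T : topologicalType)
    (K : set T) (f : T -> L) :
  compact K -> K !=set0 ->
  (forall x a, K x -> (f x < a)%O -> \forall y \near x, K y -> (f y < a)%O) ->
  exists2 x, K x & forall y, K y -> (f y <= f x)%O.
Proof.
move=> cK [x0 Kx0] usc; apply: contrapT => nomax.
have up x : K x -> exists2 y, K y & (f x < f y)%O.
  move=> Kx; apply: contrapT => noy; apply: nomax; exists x => // y Ky.
  by rewrite leNgt; apply/negP => xy; apply: noy; exists y.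
(* Tails of K ordered by the values of f: K is covered by the sets f < f z, so
   one z in K would satisfy f < f z on all of K, at z in particular. *)
pose F := filter_from K (fun z => [set z' | (f z <= f z')%O]).
have FF : Filter F.
  apply: filter_from_filter; first by exists x0.
  move=> i j Ki Kj; have [ij|ji] := leP (f i) (f j).
    by exists j => // z /= jz; split => //=; exact: le_trans jz.
  by exists i => // z /= iz; split => //=; apply: le_trans iz; exact: ltW.
have [|z Kz zP] := (near_covering_withinP K).2 
  ((compact_near_coveringP K).1 cK) T F (fun z y => (f y < f z)%O) FF.
  move=> x Kx; have [y Ky xy] := up x Kx.
  exists ([set x' | K x' -> (f x' < f y)%O], [set z | (f y <= f z)%O]) => /=.
    by split; [exact: usc|exists y].
  by move=> [x' z] /= [xy' yz] Kx'; apply: lt_le_trans yz; exact: xy'.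
by have := zP z (lexx _) z Kz; rewrite /= ltxx.
Qed.

(** Bounds, uniformly in x, the change of the competitors v x + Phi (y - x) of a
    sup-convolution when y moves. *)
Lemma near_translates_uniform (R : realType) n (Phi : 'rV[R[i]]_n -> R)
    (K : set 'rV[R[i]]_n) (y0 : 'rV[R[i]]_n) (e : R) :
  continuous Phi -> compact K -> 0 < e ->
  \forall y \near y0, forall x, K x -> `|Phi (y - x) - Phi (y0 - x)| < e.
Proof.
move=> cPhi cK e0.
apply: ((compact_near_coveringP K).1 cK _ (nbhs y0)
  (fun y x => `|Phi (y - x) - Phi (y0 - x)| < e)) => x Kx.
have e20 : 0 < e / 2 by rewrite divr_gt0.
have Px : \forall z \near y0 - x, `|Phi (y0 - x) - Phi z| < e / 2.
  by have /cvgr_dist_lt/(_ _ e20) := cPhi (y0 - x).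
have H1 : \forall p \near (x, y0), `|Phi (y0 - x) - Phi (p.2 - p.1)| < e / 2.
  have : p.2 - p.1 @[p --> (x, y0)] --> y0 - x.
    exact: (@cvgB R[i] 'rV[R[i]]_n _ (nbhs (x, y0)) _ snd fst y0 x
      cvg_snd cvg_fst).
  by move/(_ _ Px).
have H2 : \forall p \near (x, y0), `|Phi (y0 - x) - Phi (y0 - p.1)| < e / 2.
  have : y0 - p.1 @[p --> (x, y0)] --> y0 - x.
    exact: (@cvgB R[i] 'rV[R[i]]_n _ (nbhs (x, y0)) _ (cst y0) fst y0 x
      (cvg_cst _) cvg_fst).
  by move/(_ _ Px).
near=> p => /=.
have h1 : `|Phi (y0 - x) - Phi (p.2 - p.1)| < e / 2 by near: p.
have h2 : `|Phi (y0 - x) - Phi (y0 - p.1)| < e / 2 by near: p.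
by move: h1 h2; rewrite !ltr_norml => /andP[? ?] /andP[? ?]; lra.
Unshelve. all: by end_near. Qed.

(** * Plurisubharmonic functions *)

(** On a circle centred at a, such a function is its value at a plus a
    trigonometric term of mean zero: it is harmonic on every complex disc.
    Real-linear functions are the example that matters. *)
Definition circle_affine (R : realType) (m : nat) (L : 'rV[R[i]]_m -> R) :=
  forall a b, exists B C : R, forall t : R,
    L (a + (cos t +i* sin t)%C *: b) = L a + B * cos t + C * sin t.

Lemma circle_affine_rdot (R : realType) m n (M : 'M[R[i]]_(m, n))
    (p q : 'rV[R[i]]_n) (b1 b2 : R) :
  circle_affine (fun s : 'rV[R[i]]_m =>
    b1 * rdot p (s *m M) + b2 * rdot q (s *m M)).
Proof.
move=> a b.
exists (b1 * rdot p (b *m M) + b2 * rdot q (b *m M)).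
exists (b1 * rdot p ('i%C *: (b *m M)) + b2 * rdot q ('i%C *: (b *m M))).
by move=> t; rewrite mulmxDl -scalemxAl !rdot_circle; ring.
Qed.

Lemma norm_cis (R : realType) (t : R) : `|(cos t +i* sin t)%C| = 1.
Proof. by rewrite normc_def /= cos2Dsin2 sqrtr1. Qed.

Lemma continuous_circle (R : realType) m (a b : 'rV[R[i]]_m) :
  continuous (fun t : R => a + (cos t +i* sin t)%C *: b).
Proof.
move=> t; apply: cvg_rV => j.
under eq_cvg do rewrite !mxE; rewrite !mxE.
apply: cvgD; first exact: cvg_cst.
apply: cvgM; last exact: cvg_cst.
by apply: cvg_complex; [exact: continuous_cos|exact: continuous_sin].
Qed.

(** The mean over a circle of a real-linear function is its value at the centre;
    the cosine and sine terms integrate to zero over a period. *)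
Lemma integral_circle_trig (R : realType) (A B C : R) :
  (\int[@lebesgue_measure R]_(t in `[0%R, (2 * pi)%R])
     (A + B * cos t + C * sin t)%:E = (2 * pi * A)%:E)%E.
Proof.
have pi2 : 0 < 2 * pi :> R by rewrite mulr_gt0 // pi_gt0.
pose F t : R := A * t + B * sin t - C * cos t.
have dF (t : R) : is_derive t 1 F (A + B * cos t + C * sin t).
  rewrite /F; apply: is_derive_eq.
  by rewrite /GRing.scale /=; ring.
have cF : continuous F.
  move=> t; apply: differentiable_continuous; apply/derivable1_diffP.
  by have [] := dF t.
have cf : continuous (fun t : R => A + B * cos t + C * sin t).
  move=> t; apply: cvgD; first apply: cvgD; first exact: cvg_cst.
    by apply: cvgMr; exact: continuous_cos.
  by apply: cvgMr; exact: continuous_sin.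
rewrite (@continuous_FTC2 _ _ F) //.
- rewrite -EFinB /F mulr_natl sin2pi cos2pi sin0 cos0.
  by congr (_%:E); ring.
- exact: continuous_subspaceT.
- split.
  + by move=> t _; have [] := dF t.
  + by apply: cvg_at_right_filter; exact: cF.
  + by apply: cvg_at_left_filter; exact: cF.
- by move=> t _; rewrite derive1E; exact: derive_val.
Qed.

Lemma psh_translate (R : realType) m (V : set 'rV[R[i]]_m)
    (h : 'rV[R[i]]_m -> \bar R) (c : 'rV[R[i]]_m) :
  plurisubharmonic V h ->
  plurisubharmonic [set s | V (c + s)] (fun s => h (c + s)).
Proof.
move=> [uh mh]; split => [s Vs|a b Vab].
  have [hoo usc] := uh _ Vs; split=> // x /usc hx.
  by have := @continuous_translate R _ c s _ hx.
under eq_integral do rewrite addrA.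
by apply: mh => l l1; rewrite -addrA; exact: Vab.
Qed.

Lemma psh_subset (R : realType) m (V W : set 'rV[R[i]]_m)
    (h : 'rV[R[i]]_m -> \bar R) :
  W `<=` V -> plurisubharmonic V h -> plurisubharmonic W h.
Proof.
move=> WV [uh mh]; split => [s Ws|a b Wab]; last by apply: mh => l /Wab /WV.
have [hoo usc] := uh _ (WV _ Ws); split=> // x /usc.
by apply: filterS => y hy /WV.
Qed.

(** Both sides of the sub-mean value inequality change by the same amount L a.
    As h is finite and continuous, the integral over the circle is additive. *)
Lemma psh_add_circle_affine (R : realType) m (V : set 'rV[R[i]]_m)
    (h : 'rV[R[i]]_m -> \bar R) (L : 'rV[R[i]]_m -> R) :
  (forall s, V s -> h @ s --> h s) -> (forall s, V s -> h s \is a fin_num) ->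
  continuous L -> circle_affine L -> plurisubharmonic V h ->
  (forall s, V s -> (fun s => h s + (L s)%:E)%E @ s --> (h s + (L s)%:E)%E) /\
  plurisubharmonic V (fun s => h s + (L s)%:E)%E.
Proof.
move=> ch fh cL aL [uh mh].
have chL s : V s -> (fun s => h s + (L s)%:E)%E @ s --> (h s + (L s)%:E)%E.
  move=> Vs.
  apply: (@cvgeD _ (nbhs s) _ R h (EFin \o L) (h s) (L s)%:E _ (ch _ Vs)).
    by rewrite fin_num_adde_defl.
  by apply: (@cvg_EFin R _ (nbhs s)); [exact: nearW|exact: cL].
split => //; split => [s Vs|a b Vab].
  split=> [|x hx]; first by rewrite -(fineK (fh s Vs)) -EFinD ltry.
  by have := continuous_lt (chL s Vs) hx; apply: filterS.
have [B [C LBC]] := aL a b.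
have Vt t : V (a + (cos t +i* sin t)%C *: b) by apply: Vab; rewrite norm_cis.
set I := `[0%R, (2 * pi)%R]%classic.
pose g t := a + (cos t +i* sin t)%C *: b.
have mI : measurable (I : set (measurableTypeR R)) by exact: measurable_itv.
have ih : (@lebesgue_measure R).-integrable I (h \o g).
  have -> : h \o g = EFin \o (fine \o h \o g).
    by apply/funext => t /=; rewrite fineK ?fh //; exact: Vt.
  apply: continuous_compact_integrable; first exact: segment_compact.
  apply: continuous_subspaceT => t.
  apply: fine_cvg; rewrite fineK; last by apply: fh; exact: Vt.
  apply: cvg_comp; last exact: ch (Vt t).
  exact: continuous_circle.
have iL : (@lebesgue_measure R).-integrable I (EFin \o (L \o g)).
  apply: continuous_compact_integrable; first exact: segment_compact.
  apply: continuous_subspaceT => t.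
  by apply: continuous_comp; [exact: continuous_circle|exact: cL].
rewrite [X in (_ <= _ * X)%E](integralD mI ih iL).
have -> : (\int[@lebesgue_measure R]_(t in I) (EFin \o (L \o g)) t =
           (2 * pi * L a)%:E)%E.
  rewrite -(integral_circle_trig (L a) B C); apply: eq_integral => t _ /=.
  by rewrite /g LBC.
rewrite muleDr //; last by rewrite fin_num_adde_defl.
rewrite -EFinM mulrA mulVf ?mul1r; last first.
  by rewrite mulf_neq0 // gt_eqF // pi_gt0.
by rewrite leeD2r //; exact: mh.
Qed.

(** * Local maxima and subpluriharmonicity *)

(** Subpluriharmonicity is a local property: on a compact ball u + h attains its
    maximum, and a maximum that is not on the boundary is a local one. *)
Lemma no_local_max_subpluriharmonic (R : realType) m (U : set 'rV[R[i]]_m.+1)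
    (u : 'rV[R[i]]_m.+1 -> \bar R) :
  (forall t, U t -> (u t < +oo)%E) -> (forall t, U t -> u @ t --> u t) ->
  (forall (V : set 'rV[R[i]]_m.+1) (h : 'rV[R[i]]_m.+1 -> \bar R) t0,
    open V -> V t0 -> U t0 ->
    (forall t, V t -> h @ t --> h t) -> plurisubharmonic V h ->
    u t0 \is a fin_num -> h t0 \is a fin_num ->
    ~ \forall t \near t0, (u t + h t <= u t0 + h t0)%E) ->
  subpluriharmonic U u.
Proof.
move=> u_lty cu nomax; right => c r V h r0 BU oV BV ch psh_h.
have h_lty s : V s -> (h s < +oo)%E by move=> /psh_h.1[].
have {}ch s : V s -> h @ s --> h s.
  by move: ch; rewrite continuous_open_subspace // => + Vs; apply; rewrite inE.
pose f t := (u t + h t)%E.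
have f_cont t : ecball c r t -> f @ t --> f t.
  move=> Bt; have Ut := BU t Bt; have Vt := BV t Bt.
  apply: (@cvgeD _ (nbhs t) _ R _ _ _ _ _ (cu _ Ut) (ch _ Vt)).
  by apply: ltpinfty_adde_def; rewrite inE ?u_lty ?h_lty.
have [t0 Bt0 t0max] : exists2 t, ecball c r t &
    forall s, ecball c r s -> (f s <= f t)%E.
  apply: usc_attains_max; first exact: compact_ecball.
    by exists c; rewrite /ecball /= subrr enorm0 ltW.
  by move=> t b Bt ft; have := continuous_lt (f_cont t Bt) ft; apply: filterS.
have [t0r|t0r] := eqVneq (enorm (t0 - c)) r; first by exists t0.
have {}t0r : enorm (t0 - c) < r by rewrite lt_neqAle t0r.
(* If the maximum is -oo, then f is -oo on the ball and every boundary point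
   realizes the maximum. *)
have [ft0N|ft0N] := eqVneq (f t0) -oo%E.
  have [z zr] := esphere_neq0 c r0; exists z => // s /t0max.
  by rewrite -/(f s) ft0N leeNy_eq => /eqP ->; exact: leNye.
have Ut0 := BU _ Bt0; have Vt0 := BV _ Bt0; exfalso.
apply: (nomax V h t0) => //.
- apply: lty_fin_num; first exact: u_lty.
  by apply: contra_neq ft0N; rewrite /f => ->; rewrite addNye.
- apply: lty_fin_num; first exact: h_lty.
  by apply: contra_neq ft0N; rewrite /f => ->; rewrite addeNy.
have : \forall t \near t0, enorm (t - c) < r.
  exact: (cvgr_lt _ (@continuous_enorm_sub R _ c t0) _ t0r).
by apply: filterS => t tr; apply: t0max; exact: ltW.
Qed.

(** For e' > e the function in the last condition is, up to a constant,
      (u - e' |.|^2) (x + s M) + (h s + L s) + (e' - e) |s|^2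
    with L real-linear, because |x + s M|^2 and |y + s M|^2 both have |s|^2 as
    their second-order part, whatever x and y are. Here h + L is again
    plurisubharmonic, so on small spheres around 0 the first two terms reach
    their value at 0, and the third term, positive on these spheres, excludes a
    maximum at 0. Allowing y to differ from x is what makes the lemma applicable
    to a translate of u. *)
Lemma qpsh_no_local_max (R : realType) (n q : nat) (D : set 'rV[R[i]]_n)
    (u : 'rV[R[i]]_n -> \bar R) (e e' : R) (x y : 'rV[R[i]]_n)
    (M : 'M[R[i]]_(q.+1, n)) (V : set 'rV[R[i]]_q.+1)
    (h : 'rV[R[i]]_q.+1 -> \bar R) :
  (q < n)%N -> M \is unitarymx -> e < e' ->
  qpsh q D (fun z => u z - (e' * enorm z ^+ 2)%:E)%E -> nbhs x D ->
  open V -> V 0 -> (forall s, V s -> h @ s --> h s) -> plurisubharmonic V h ->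
  u x \is a fin_num -> h 0 \is a fin_num ->
  ~ \forall s \near (0 : 'rV[R[i]]_q.+1),
      (u (x + s *m M)%R + h s - (e * enorm (y + s *m M) ^+ 2)%:E
       <= u x + h 0%R - (e * enorm y ^+ 2)%:E)%E.
Proof.
move=> qn Mu ee' [uscD subD] Dx oV V0 ch psh_h ux h0 xmax.
(* The real-linear part of e' |x + s M|^2 - e |y + s M|^2. *)
pose L (s : 'rV[R[i]]_q.+1) :=
  (2 * e') * rdot x (s *m M) + (- (2 * e)) * rdot y (s *m M).
(* h may take the value -oo, but not close to 0. *)
pose V' : set 'rV[R[i]]_q.+1 := [set s | V s /\ (-oo < h s)%E].
have oV' : open V'.
  rewrite openE => s [Vs hs]; rewrite /interior; apply: filterI.
    exact: open_nbhs_nbhs.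
  exact: continuous_gt (ch s Vs) hs.
have fin_h s : V' s -> h s \is a fin_num.
  move=> [Vs hs]; apply: lty_fin_num; first by have [] := psh_h.1 s Vs.
  by rewrite -ltNye.
have [cL psh_L] : (forall s, V' s -> (fun s => h s + (L s)%:E)%E @ s -->
      (h s + (L s)%:E)%E) /\ plurisubharmonic V' (fun s => h s + (L s)%:E)%E.
  apply: psh_add_circle_affine fin_h _ _ _.
  - by move=> s [Vs _]; exact: ch.
  - exact: continuous_rdot_mulmxr.
  - exact: circle_affine_rdot.
  - by apply: psh_subset psh_h => s [].
have nD : \forall s \near (0 : 'rV[R[i]]_q.+1), D (x + s *m M).
  have := @continuous_affine R _ _ x M 0.
  by rewrite /continuous_at mul0mx addr0 => /(_ _ Dx).
have nV : \forall s \near (0 : 'rV[R[i]]_q.+1), V' s.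
  apply: open_nbhs_nbhs; split=> //; split=> //.
  by move: h0; rewrite fin_numE ltNye => /andP[].
have [rho0 rho0_gt0 near_ok] :=
  (nbhs_eballP _ _).1 (filterI (filterI nD nV) xmax).
(* Halved so that the closed ball still lies in the neighbourhood. *)
pose rho := rho0 / 2; have rho_gt0 : 0 < rho by rewrite divr_gt0.
have {}near_ok s : ecball 0 rho s -> [/\ D (x + s *m M), V' s &
    (u (x + s *m M)%R + h s - (e * enorm (y + s *m M) ^+ 2)%:E
       <= u x + h 0%R - (e * enorm y ^+ 2)%:E)%E].
  move=> sr; suff /near_ok[[]] : eball 0 rho0 s by [].
  by apply: le_lt_trans sr _; rewrite ltr_pdivrMr // ltr_pMr // ltr1n.
have B0 : ecball 0 rho (0 : 'rV[R[i]]_q.+1).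
  by rewrite /ecball /= subrr enorm0 ltW.
have [uN|/(_ 0 rho V' (fun s => h s + (L s)%:E)%E rho_gt0)] := subD qn x M Mu.
  have [D0 _ _] := near_ok 0 B0; move: (uN 0 D0) ux.
  by rewrite mul0mx addr0; case: (u x).
case => //.
- by move=> s /near_ok[].
- by move=> s /near_ok[].
- by rewrite continuous_open_subspace // => s; rewrite inE => /cL.
move=> z zr /(_ 0 B0).
have [Dz Vz] : [/\ D (x + z *m M), V' z &
    (u (x + z *m M)%R + h z - (e * enorm (y + z *m M) ^+ 2)%:E
       <= u x + h 0%R - (e * enorm y ^+ 2)%:E)%E].
  by apply: near_ok; move: zr; rewrite /esphere /ecball /= => ->.
have zrho : enorm (z *m M) = rho.
  by rewrite enorm_unitary //; move: zr; rewrite /esphere /= subr0.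
have uz_lty : (u (x + z *m M)%R < +oo)%E.
  by move: (uscD _ Dz).1; rewrite !ltey; apply: contra_neq => ->.
rewrite mul0mx addr0 !sqr_enormD zrho /L mul0mx.
rewrite -(fineK ux) -(fineK h0) -(fineK (fin_h z Vz)).
case: (u (x + z *m M)) uz_lty => [uz| |] // _.
have rdot0 p : rdot p (0 : 'rV[R[i]]_n) = 0.
  by apply: big1 => j _; rewrite mxE /= !mulr0 addr0.
rewrite -?(EFinD, EFinB) ?lee_fin !rdot0 => h1 h2.
have : 0 < (e' - e) * rho ^+ 2 by rewrite mulr_gt0 ?exprn_gt0 // subr_gt0.
by lra.
Qed.

(** Strictness provides a constant around each point; by compactness some e > 0
    lies strictly below the constants needed to cover K. *)
Lemma strictly_qpsh_uniform (R : realType) n q (U K : set 'rV[R[i]]_n)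
    (u : 'rV[R[i]]_n -> \bar R) :
  strictly_qpsh q U u -> compact K -> K `<=` U ->
  exists2 e : R, 0 < e & forall x, K x -> exists D e',
    [/\ e < e', nbhs x D & qpsh q D (fun z => u z - (e' * enorm z ^+ 2)%:E)%E].
Proof.
move=> [_ su] cK KU.
pose good (e : R) (x : 'rV[R[i]]_n) := exists D e', [/\ e < e', nbhs x D &
  qpsh q D (fun z => u z - (e' * enorm z ^+ 2)%:E)%E].
have : \forall e \near (0 : R)^'+, K `<=` good e.
  apply: ((compact_near_coveringP K).1 cK) => x Kx.
  have [e' [r [e'0 r0 _ qp]]] := su x (KU x Kx).
  exists (eball x r, [set e | e < e']) => /=.
    by split; [exact: nbhs_eball|exact: nbhs_right_lt].
  move=> [y e] /= [xy ee']; exists (eball x r), e'; split=> //.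
  by apply: open_nbhs_nbhs; split=> //; exact: open_eball.
move=> eK; near (0 : R)^'+ => e; exists e.
  by near: e; exact: nbhs_right_gt.
by near: e.
Unshelve. all: by end_near. Qed.

(** * Sup-convolutions *)

Lemma supconv_ge (R : realType) n (X : set 'rV[R[i]]_n)
    (v Phi : 'rV[R[i]]_n -> \bar R) x y :
  X x -> (v x + Phi (y - x)%R <= supconv X v Phi y)%E.
Proof. by move=> Xx; apply: ereal_sup_ubound; exists x. Qed.

(** Changing y to y0 moves every competitor of the supremum by at most e. *)
Lemma near_supconv_le (R : realType) n (X : set 'rV[R[i]]_n)
    (v : 'rV[R[i]]_n -> \bar R) (Phi : 'rV[R[i]]_n -> R)
    (y0 : 'rV[R[i]]_n) (e : R) :
  continuous Phi -> compact (closure X) -> 0 < e ->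
  \forall y \near y0,
    (supconv X v (EFin \o Phi) y <= supconv X v (EFin \o Phi) y0 + e%:E)%E /\
    (supconv X v (EFin \o Phi) y0 <= supconv X v (EFin \o Phi) y + e%:E)%E.
Proof.
move=> cPhi cX e0.
have le_shift y z : (forall x, X x -> Phi (y - x) <= Phi (z - x) + e) ->
    (supconv X v (EFin \o Phi) y <= supconv X v (EFin \o Phi) z + e%:E)%E.
  move=> yz; apply: ge_ereal_sup => _ [x Xx <-].
  apply: (@le_trans _ _ ((v x + (Phi (z - x))%:E) + e%:E)%E).
    by rewrite -addeA leeD2l // -EFinD lee_fin yz.
  by rewrite leeD2r // (supconv_ge _ (EFin \o Phi)).
have := near_translates_uniform y0 cPhi cX e0; apply: filterS => y yP.
by split; apply: le_shift => x /subset_closure /yP;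
  rewrite ltr_norml => /andP[? ?]; lra.
Qed.

Lemma supconv_continuous_at (R : realType) n (X : set 'rV[R[i]]_n)
    (v : 'rV[R[i]]_n -> \bar R) (Phi : 'rV[R[i]]_n -> R) (y0 : 'rV[R[i]]_n) :
  continuous Phi -> compact (closure X) ->
  (supconv X v (EFin \o Phi) y0 < +oo)%E ->
  supconv X v (EFin \o Phi) @ y0 --> supconv X v (EFin \o Phi) y0.
Proof.
move=> cPhi cX; set w := supconv X v (EFin \o Phi).
have wnear e : 0 < e -> \forall y \near y0,
    (w y <= w y0 + e%:E)%E /\ (w y0 <= w y + e%:E)%E.
  exact: near_supconv_le.
case wy0 : (w y0) => [r| |] // _.
- rewrite wy0 in wnear; apply: (@cvg_EFin R _ (nbhs y0)).
    have := wnear 1 ltr01; apply: filterS => y.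
    by case: (w y) => [s| |] // [].
  apply/cvgrPdist_le => /= e e0.
  have := wnear e e0; apply: filterS => y /=.
  case: (w y) => [s| |] //= []; rewrite -?EFinD ?lee_fin => // ? ?.
  by rewrite ler_norml; lra.
  (* Here -oo + 1 = -oo forces w to be -oo on a whole neighbourhood. *)
- have := wnear 1 ltr01; rewrite wy0 => wNy A AN.
  apply: filterS wNy => y /= [+ _]; rewrite leeNy_eq => /eqP ->.
  exact: nbhs_singleton.
Qed.

(** Cancels p between the inequality that expresses touching and the one that
    expresses maximality; us, ws and hs may be infinite. *)
Lemma lee_touch (R : realType) (us ws hs : \bar R) (p a b ux ht : R) :
  (us + p%:E <= ws)%E ->
  (ws - a%:E + hs <= ux%:E + p%:E - b%:E + ht%:E)%E ->
  (us + hs - a%:E <= ux%:E + ht%:E - b%:E)%E.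
Proof.
case: us => [us| |]; last by move=> _ _; rewrite !addNye leNye.
  case: hs => [hs| |]; last by move=> _ _; rewrite addeNy addNye leNye.
    case: ws => [ws| |] //.
    by rewrite -?(EFinD, EFinB) !lee_fin; lra.
  by case: ws.
by case: ws => [ws| |] //; case: hs => [hs| |] // _ _;
  rewrite addeNy addNye leNye.
Qed.

(** Where the supremum at y0 is attained, at x say, the translate of u by y0 - x
    plus a constant touches the sup-convolution from below at y0. So u inherits,
    at x, any local maximum at y0 that the sup-convolution has after adding a
    function, and [qpsh_no_local_max] excludes it. *)
Lemma supconv_minus_sqr_enorm_qpsh (R : realType) (n q : nat)
    (X S : set 'rV[R[i]]_n)
    (u : 'rV[R[i]]_n -> \bar R) (Phi : 'rV[R[i]]_n -> R) (e : R) :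
  open X ->
  (forall x, X x -> (u x < +oo)%E) ->
  (forall x, X x -> exists D e',
    [/\ e < e', nbhs x D &
        qpsh q D (fun z => u z - (e' * enorm z ^+ 2)%:E)%E]) ->
  S `<=` proper_supconv X u (EFin \o Phi) ->
  (forall y, S y ->
    supconv X u (EFin \o Phi) @ y --> supconv X u (EFin \o Phi) y) ->
  qpsh q S (fun y => supconv X u (EFin \o Phi) y - (e * enorm y ^+ 2)%:E)%E.
Proof.
move=> oX uoo ue SP cw; set w := supconv X u (EFin \o Phi) in cw *.
have w_lty y : S y -> (w y < +oo)%E.
  move=> /SP[x Xx wyx]; rewrite /w wyx; have := uoo x Xx.
  by case: (u x) => // s _; rewrite -EFinD ltry.
pose g y := (w y - (e * enorm y ^+ 2)%:E)%E.
have g_lty y : S y -> (g y < +oo)%E.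
  by move=> /w_lty; rewrite /g; case: (w y) => // s _; rewrite -EFinB ltry.
have cg y : S y -> g @ y --> g y.
  move=> Sy.
  have n2 : (fun z : 'rV[R[i]]_n => enorm z ^+ 2) @ y --> enorm y ^+ 2.
    exact: (cvg_comp _ _ (@continuous_enorm R n y) (@exprn_continuous R 2 _)).
  have e2 : (fun z => (- (e * enorm z ^+ 2))%:E) @ y -->
            (- (e * enorm y ^+ 2))%:E.
    apply: (@cvg_EFin R _ (nbhs y)); first exact: nearW.
    exact: (cvgN (cvgMr n2)).
  apply: (@cvgeD _ (nbhs y) _ R _ _ _ _ _ (cw _ Sy) e2).
  by rewrite fin_num_adde_defl.
split=> [y Sy|qn a M Mu].
  split=> [|b gb]; first exact: g_lty.
  by have := continuous_lt (cg y Sy) gb; apply: filterS.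
apply: no_local_max_subpluriharmonic.
- by move=> t; exact: g_lty.
- move=> t St.
  exact: (cvg_comp _ _ (@continuous_affine R _ _ a M t) (cg _ St)).
move=> V h t0 oV Vt0 St0 ch psh_h gt0 ht0 t0max.
set y0 := a + t0 *m M in St0 gt0.
have [x Xx wx] := SP _ St0.
have [D [e' [ee' Dx qp]]] := ue x Xx.
have ux : u x \is a fin_num.
  by move: gt0; rewrite /g /w -/y0 wx; case: (u x) (uoo x Xx).
apply: (qpsh_no_local_max (V := [set s | V (t0 + s)]) (h := fun s => h (t0 + s))
  (y := y0) qn Mu ee' qp Dx) => //.
- apply: open_comp oV => s _; exact: continuous_translate.
- by rewrite /= addr0.
- move=> s Vs.
  exact: (cvg_comp _ _ (@continuous_translate R _ t0 s) (ch _ Vs)).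
- exact: psh_translate.
- by rewrite addr0.
have nX : \forall s \near (0 : 'rV[R[i]]_q.+1), X (x + s *m M).
  have := @continuous_affine R _ _ x M 0; rewrite /continuous_at mul0mx addr0.
  by apply; exact: open_nbhs_nbhs.
have nmax : \forall s \near (0 : 'rV[R[i]]_q.+1),
    (g (a + (t0 + s) *m M)%R + h (t0 + s)%R <= g y0 + h t0)%E.
  have := @continuous_translate R _ t0 0; rewrite /continuous_at addr0.
  by move=> /(_ _ t0max).
(* The translate of u that touches the sup-convolution from below at y0 passes
   the local maximum on to x. *)
apply: filterS (filterI nX nmax) => s [Xs].
rewrite mulmxDl addrA -/y0 addr0 /g /w wx.
have := supconv_ge u (EFin \o Phi) (y0 + s *m M) Xs; rewrite -/w.
have -> : y0 + s *m M - (x + s *m M) = y0 - x.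
  by rewrite opprD addrACA subrr addr0.
rewrite -/y0 -(fineK ux) -(fineK ht0) /=.
exact: lee_touch.
Qed.

(** * Sup-convolutions of strictly q-plurisubharmonic functions *)

Theorem corollary4p4 (R : realType) (n q : nat)
  (U : set 'rV[R[i]]_n) (u : 'rV[R[i]]_n -> \bar R)
  (Phi : 'rV[R[i]]_n -> R) (delta : R) (Omega : set 'rV[R[i]]_n)
  (U_open : open U) (U_neq0 : U !=set0) (u_strict : strictly_qpsh q U u)
  (Phi_cont : continuous Phi)
  (delta_gt0 : 0 < delta) (Phi_semiconvex : semiconvex Phi delta)
  (Omega_open : open Omega) (Omega_compact : compact (closure Omega))
  (Omega_sub : closure Omega `<=` U)
  (W := (proper_supconv Omega u (EFin \o Phi))°)
  (W_neq0 : W !=set0) :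
  {within W, continuous (supconv Omega u (EFin \o Phi))} /\
  strictly_qpsh q W (supconv Omega u (EFin \o Phi)).
Proof.
set w := supconv Omega u (EFin \o Phi).
have OmegaU x : Omega x -> U x by move/subset_closure/Omega_sub.
have u_lty x : Omega x -> (u x < +oo)%E by move=> /OmegaU/u_strict.1[].
have W_proper y : W y -> proper_supconv Omega u (EFin \o Phi) y.
  exact: interior_subset.
have w_lty y : W y -> (w y < +oo)%E.
  move=> /W_proper[x Ox wyx]; rewrite /w wyx; have := u_lty x Ox.
  by case: (u x) => // s _; rewrite -EFinD ltry.
have cw y : W y -> w @ y --> w y.
  by move=> Wy; apply: supconv_continuous_at => //; exact: w_lty.
have oW : open W by exact: open_interior.
split; first by rewrite continuous_open_subspace // => y; rewrite inE => /cw.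
split=> [y Wy|y Wy].
  split=> [|b wb]; first exact: w_lty.
  by have := continuous_lt (cw y Wy) wb; apply: filterS.
have [e e0 ue] := strictly_qpsh_uniform u_strict Omega_compact Omega_sub.
have [r r0 rW] := (nbhs_eballP y W).1 (open_nbhs_nbhs (conj oW Wy)).
exists e, r; split=> //.
apply: supconv_minus_sqr_enorm_qpsh => //.
- by move=> x /subset_closure/ue.
- by move=> z /rW/W_proper.
- by move=> z /rW/cw.
Qed.
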